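(* For $n\ge 3$, the commutator subgroup $WB_n'=[WB_n,WB_n]$ of the welded braid group $WB_n$ is perfect if and only if $n\ge 5$.
   Context: The welded braid group $WB_n$ is the group with generators $\sigma_i,\rho_i$ ($1\le i\le n-1$) and the following defining relations (for all indices for which they make sense): braid relations $\sigma_i\sigma_j=\sigma_j\sigma_i$ if $|i-j|>1$, $\sigma_i\sigma_{i+1}\sigma_i=\sigma_{i+1}\sigma_i\sigma_{i+1}$; symmetric relations $\rho_i^2=1$, $\rho_i\rho_j=\rho_j\rho_i$ if $|i-j|>1$, $\rho_i\rho_{i+1}\rho_i=\rho_{i+1}\rho_i\rho_{i+1}$; mixed relations $\sigma_i\rho_j=\rho_j\sigma_i$ if $|i-j|>1$, $\rho_i\rho_{i+1}\sigma_i=\sigma_{i+1}\rho_i\rho_{i+1}$; forbidden relations $\rho_i\sigma_{i+1}\sigma_i=\sigma_{i+1}\sigma_i\rho_{i+1}$. A group is perfect if it equals its commutator subgroup. *)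

(* Defs.v *)
From HB Require Import structures.
From mathcomp Require Import all_boot.
From mathcomp Require Import boolp classical_sets.

Set Implicit Arguments.
Unset Strict Implicit.
Unset Printing Implicit Defensive.

Local Open Scope quotient_scope.
Local Open Scope classical_set_scope.
Local Open Scope group_scope.

(** A word is a sequence of letters [(x, b)], where [(x, false)] stands for the
    generator [x] and [(x, true)] for its formal inverse.  For a set [R] of
    relations [u = v] between words, [presented R] is the set of words modulo
    the least congruence that contains [R] and cancels adjacent inverse
    letters. *)

Notation word X := (seq (X * bool)%type).

Section Presentation.
Variable X : choiceType.

Definition letter_inv (l : X * bool) : X * bool := (l.1, ~~ l.2).
Definition word_inv (w : word X) : word X := rev (map letter_inv w).

Variable R : word X -> word X -> Prop.

Inductive pres_eq : word X -> word X -> Prop :=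
| pres_refl u : pres_eq u u
| pres_sym u v : pres_eq u v -> pres_eq v u
| pres_trans v u w : pres_eq u v -> pres_eq v w -> pres_eq u w
| pres_cat u u' v v' :
    pres_eq u u' -> pres_eq v v' -> pres_eq (u ++ v) (u' ++ v')
| pres_cancel l : pres_eq [:: l; letter_inv l] [::]
| pres_rel u v : R u v -> pres_eq u v.

Definition pres_eqb : rel (word X) := fun u v => `[< pres_eq u v >].

Lemma pres_eqb_refl : reflexive pres_eqb.
Proof. by move=> u; apply/asboolP; exact: pres_refl. Qed.

Lemma pres_eqb_sym : symmetric pres_eqb.
Proof.
by move=> u v; apply/asboolP/asboolP => ?; exact: pres_sym.
Qed.

Lemma pres_eqb_trans : transitive pres_eqb.
Proof.
move=> v u w /asboolP uv /asboolP vw.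
by apply/asboolP; exact: pres_trans vw.
Qed.

Canonical pres_equiv :=
  EquivRel pres_eqb pres_eqb_refl pres_eqb_sym pres_eqb_trans.

Definition presented : Type := {eq_quot pres_eqb}.
HB.instance Definition _ := Choice.on presented.
HB.instance Definition _ := EqQuotient.on presented.

Definition pres_one : presented := lift_cst presented [::].
Definition pres_mul : presented -> presented -> presented :=
  lift_op2 presented cat.
Definition pres_inv : presented -> presented :=
  lift_op1 presented word_inv.

Lemma pres_piP (u v : word X) :
  \pi_presented u = \pi_presented v <-> pres_eq u v.
Proof.
split=> [/eqP|uv]; first by rewrite piE => /asboolP.
by apply/eqP; rewrite piE; apply/asboolP.
Qed.

Lemma pres_repr (u : word X) : pres_eq (repr (\pi_presented u)) u.
Proof. by apply/pres_piP; rewrite reprK. Qed.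

Lemma pres_oneE : pres_one = \pi_presented [::].
Proof. by rewrite /pres_one -lock. Qed.

Lemma pres_mulE (u v : word X) :
  pres_mul (\pi_presented u) (\pi_presented v)
    = \pi_presented (u ++ v).
Proof.
by rewrite /pres_mul -lock; apply/pres_piP; apply: pres_cat; exact: pres_repr.
Qed.

Lemma letter_invK : involutive letter_inv.
Proof. by case=> x b; rewrite /letter_inv /= negbK. Qed.

Lemma word_invK : involutive word_inv.
Proof.
by move=> w; rewrite /word_inv map_rev revK mapK //; exact: letter_invK.
Qed.

Lemma pres_catV (u : word X) : pres_eq (u ++ word_inv u) [::].
Proof.
elim: u => [|l u IHu]; first exact: pres_refl.
rewrite /word_inv /= rev_cons -cats1 catA.
apply: pres_trans (pres_cancel l).
rewrite -[l :: _]cat1s -(cat1s l [:: letter_inv l]).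
apply: pres_cat; first exact: pres_refl.
rewrite -[X in pres_eq _ X]cat0s.
by apply: pres_cat => //; exact: pres_refl.
Qed.

Lemma pres_invE (u : word X) :
  pres_inv (\pi_presented u) = \pi_presented (word_inv u).
Proof.
rewrite /pres_inv -lock; apply/pres_piP; set v := repr _.
have uv : pres_eq u v by apply: pres_sym; exact: pres_repr.
have vV : pres_eq (word_inv v ++ v) [::].
  by rewrite -{2}[v]word_invK; exact: pres_catV.
apply: (@pres_trans (word_inv v ++ (u ++ word_inv u))).
  rewrite -[X in pres_eq X _]cats0.
  by apply: pres_cat; [exact: pres_refl|apply: pres_sym; exact: pres_catV].
rewrite catA -[X in pres_eq _ X]cat0s.
apply: pres_cat; last exact: pres_refl.
by apply: pres_trans vV; apply: pres_cat => //; exact: pres_refl.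
Qed.

Lemma pres_mulA : associative pres_mul.
Proof.
by elim/quotW=> u; elim/quotW=> v; elim/quotW=> w; rewrite !pres_mulE catA.
Qed.

Lemma pres_mul1 : left_id pres_one pres_mul.
Proof. by elim/quotW=> u; rewrite pres_oneE pres_mulE. Qed.

Lemma pres_mulr1 : right_id pres_one pres_mul.
Proof. by elim/quotW=> u; rewrite pres_oneE pres_mulE cats0. Qed.

Lemma pres_mulrV : right_inverse pres_one pres_inv pres_mul.
Proof.
elim/quotW=> u; rewrite pres_oneE pres_invE pres_mulE; apply/pres_piP.
exact: pres_catV.
Qed.

Lemma pres_mulV : left_inverse pres_one pres_inv pres_mul.
Proof.
elim/quotW=> u; rewrite pres_oneE pres_invE pres_mulE; apply/pres_piP.
by rewrite -{2}[u]word_invK; exact: pres_catV.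
Qed.

HB.instance Definition _ := isGroup.Build presented
  pres_mulA pres_mul1 pres_mulr1 pres_mulV pres_mulrV.

End Presentation.

Section Derived.
Variable G : groupType.

Definition gen_subgroup (A : set G) : set G :=
  smallest (fun H : set G => group_closed [in H]) A.

Definition commutator_subgroup (H : set G) : set G :=
  gen_subgroup [set [~ x, y] | x in H & y in H].

Definition perfect (H : set G) : Prop := commutator_subgroup H = H.

End Derived.

(** Indices are shifted by one: [i : 'I_n.-1] indexes the generators usually
    written sigma_{i+1} and rho_{i+1}, which form the left and right summands
    of [WB_gen]. *)

Section WeldedBraid.
Variable n : nat.
Implicit Types i j : 'I_n.-1.

Definition WB_gen : choiceType := ('I_n.-1 + 'I_n.-1)%type.

Definition sigma (i : 'I_n.-1) : WB_gen * bool := (inl i, false).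
Definition rho (i : 'I_n.-1) : WB_gen * bool := (inr i, false).

Definition far i j : bool := (i.+1 < j)%N || (j.+1 < i)%N.

Inductive WB_rel : word WB_gen -> word WB_gen -> Prop :=
| braid_comm i j : far i j ->
    WB_rel [:: sigma i; sigma j] [:: sigma j; sigma i]
| braid_adj i j : j = i.+1 :> nat ->
    WB_rel [:: sigma i; sigma j; sigma i] [:: sigma j; sigma i; sigma j]
| symm_invol i :
    WB_rel [:: rho i; rho i] [::]
| symm_comm i j : far i j ->
    WB_rel [:: rho i; rho j] [:: rho j; rho i]
| symm_adj i j : j = i.+1 :> nat ->
    WB_rel [:: rho i; rho j; rho i] [:: rho j; rho i; rho j]
| mixed_comm i j : far i j ->
    WB_rel [:: sigma i; rho j] [:: rho j; sigma i]
| mixed_adj i j : j = i.+1 :> nat ->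
    WB_rel [:: rho i; rho j; sigma i] [:: sigma j; rho i; rho j]
| forbidden i j : j = i.+1 :> nat ->
    WB_rel [:: rho i; sigma j; sigma i] [:: sigma j; sigma i; rho j].

Definition WB : groupType := presented WB_rel.

End WeldedBraid.

(* Main.v *)
From HB Require Import structures.
Require Import Defs.
From mathcomp Require Import all_boot perm cyclic alt.
From mathcomp Require Import boolp classical_sets.

(** Write [G = WB n], and number the generators from 0.  If [x] and [y] satisfy
    the braid relation [x y x = y x y], then [x^-1 y] is a conjugate of their
    commutator ([braid_cong]).  So, modulo a normal subgroup, two generators
    that satisfy the braid relation agree as soon as they commute.  In
    particular all the sigma_i agree modulo [G'], and so do all the rho_i.

    For [n >= 5] it suffices that [G] be abelian modulo [G''].  If [z] commutes
    with [x] and [y], and all three agree modulo [G'], then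
    [[x, y] = [z^-1 x, z^-1 y]] lies in [G'']
    ([comm_common_centralizer]).  Let [x_0, x_1, x_2, x_3] and so on be the
    sigma_i, or the rho_i.  Since [x_3] commutes with [x_0] and [x_1], and
    [x_0] commutes with [x_i] and [x_(i+1)] for [i >= 2], these pairs of
    adjacent generators commute modulo [G''], hence agree modulo [G''].  For
    [n = 5] no [x_j] commutes with both [x_1] and [x_2], but [x_1] agrees with
    [x_0], which commutes with [x_2].  So all the [x_i] agree modulo [G'']
    ([braid_family_cong0]), which leaves one sigma and one rho; they commute
    modulo [G''] because sigma_0 commutes with rho_2.

    For [n = 3] and [n = 4] the group [G] maps onto the symmetric group S_3 by
    sending both sigma_i and rho_i to a transposition that depends only on the
    parity of [i].  The image of [G'] is contained in the abelian group A_3, so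
    the image of [G''] is trivial.  If [G'] were perfect, the image of [G']
    would be trivial too, and S_3 would be abelian
    ([perfect_derived_image]). *)

Set Implicit Arguments.
Unset Strict Implicit.
Unset Printing Implicit Defensive.

Local Open Scope quotient_scope.
Local Open Scope classical_set_scope.
Local Open Scope group_scope.

(** * Normal subgroups and commutators *)

Section Subgroups.
Variable G : groupType.
Implicit Types (H K : set G) (x y z g : G).

Lemma group_closedE K :
  group_closed [in K] <-> K 1 /\ (forall x y, K x -> K y -> K (x / y)).
Proof.
split=> -[K1 KF]; split.
- by rewrite -in_setE.
- by move=> x y /mem_set Kx /mem_set Ky; rewrite -in_setE; exact: KF.
- exact/mem_set.
- by move=> x y /set_mem Kx /set_mem Ky; apply/mem_set; exact: KF.
Qed.

Definition normal_subgroup K :=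
  group_closed [in K] /\ forall x g, K x -> K (x ^ g).

Section Normal.
Variable K : set G.
Hypothesis nK : normal_subgroup K.

Lemma normal1 : K 1.
Proof. by case: nK => /group_closedE[]. Qed.

Lemma normalF x y : K x -> K y -> K (x / y).
Proof. by case: nK => /group_closedE[_ KF] _; exact: KF. Qed.

Lemma normalV x : K x -> K x^-1.
Proof. by rewrite -div1g; apply: normalF; exact: normal1. Qed.

Lemma normalM x y : K x -> K y -> K (x * y).
Proof. by move=> Kx /normalV Ky; rewrite -[y]invgK; exact: normalF. Qed.

Lemma normalJ x g : K x -> K (x ^ g).
Proof. by case: nK => _; exact. Qed.

Definition cong x y := K (x^-1 * y).

Lemma cong_refl x : cong x x.
Proof. by rewrite /cong mulVg; exact: normal1. Qed.

Lemma cong_sym x y : cong x y -> cong y x.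
Proof. by move=> /normalV; rewrite invgM invgK. Qed.

Lemma cong_trans y x z : cong x y -> cong y z -> cong x z.
Proof. by move=> xy yz; have := normalM xy yz; rewrite -mulgA mulVKg. Qed.

Definition commute_mod x y := K [~ x, y].

Lemma commute_mod_commute x y : commute x y -> commute_mod x y.
Proof. by move=> /commgP/eqP xy; rewrite /commute_mod xy; exact: normal1. Qed.

Lemma commute_mod_sym x y : commute_mod x y -> commute_mod y x.
Proof. by move=> /normalV; rewrite invgR. Qed.

(** Being a subgroup, the centralizer modulo [K] of an element only has to be
    tested on generators. *)
Lemma commute_mod_closed y : group_closed [in [set x | commute_mod x y]].
Proof.
apply/group_closedE; split=> [|x z]; rewrite /= /commute_mod.
  by rewrite comm1g; exact: normal1.
move=> Kx Kz; have -> : [~ x / z, y] = ([~ x, y] / [~ z, y]) ^ z^-1.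
  by rewrite invgR !commgEl /conjg !(invgM, invgK) -!mulgA mulgV mulg1 mulVKg.
by apply: normalJ; exact: normalF.
Qed.

Lemma commute_mod_cong x x' y :
  cong x x' -> commute_mod x' y -> commute_mod x y.
Proof.
move=> /cong_sym xx' x'y; rewrite -[x](mulVKg x').
have /group_closedE[C1 CF] := commute_mod_closed y.
have Kxx' : commute_mod (x'^-1 * x)^-1 y.
  rewrite /commute_mod commgEl invgK.
  by apply: normalM => //; apply/normalJ/normalV.
by rewrite -[x'^-1 * x]invgK; exact: CF.
Qed.

(** The braid relation says exactly that [x^-1 * y = [~ x, y] ^ x]. *)
Lemma braid_cong x y :
  x * y * x = y * x * y -> commute_mod x y -> cong x y.
Proof.
move=> braid xy; rewrite /cong; have -> : x^-1 * y = [~ x, y] ^ x.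
  move: braid; rewrite commgEl /conjg -!mulgA => ->.
  by rewrite !mulKg.
exact: normalJ.
Qed.

End Normal.

Lemma normal_setT : normal_subgroup [set: G].
Proof. by split=> //; apply/group_closedE. Qed.

Lemma commutator_subgroup_comm H x y :
  H x -> H y -> commutator_subgroup H [~ x, y].
Proof. by move=> Hx Hy; apply: sub_gen_smallest; exists x => //; exists y. Qed.

Lemma commutator_subgroup_sub H K : group_closed [in K] ->
    (forall x y, H x -> H y -> K [~ x, y]) ->
  commutator_subgroup H `<=` K.
Proof.
move=> cK HK; apply: smallest_sub => //.
by move=> _ [x Hx [y Hy <-]]; exact: HK.
Qed.

Lemma commutator_subgroup_closed H : group_closed [in commutator_subgroup H].
Proof.
apply/group_closedE; split=> [|x y Hx Hy] K /= [cK HK].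
  by case/group_closedE: cK.
by case/group_closedE: (cK) => _; apply; [apply: Hx | apply: Hy].
Qed.

Lemma commutator_subgroup_normal H :
  normal_subgroup H -> normal_subgroup (commutator_subgroup H).
Proof.
move=> nH; split=> [|x g Hx]; first exact: commutator_subgroup_closed.
have /group_closedE[D1 DF] := commutator_subgroup_closed H.
pose K : set G := [set x | commutator_subgroup H (x ^ g)].
suff: commutator_subgroup H `<=` K by exact.
apply: commutator_subgroup_sub.
  apply/group_closedE; rewrite /K /=; split=> [|y z Hy Hz].
    by rewrite conj1g.
  by rewrite conjMg conjVg; exact: DF.
move=> y z Hy Hz; rewrite /K /= conjRg.
by apply: commutator_subgroup_comm; exact: normalJ.
Qed.

(** Multiplying [x] and [y] by [z^-1] brings them into [H] and does not change
    their commutator. *)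
Lemma comm_common_centralizer H x y z :
    commute z x -> commute z y -> cong H z x -> cong H z y ->
  commute_mod (commutator_subgroup H) x y.
Proof.
move=> zx zy Hx Hy; rewrite /commute_mod.
have -> : [~ x, y] = [~ z^-1 * x, z^-1 * y].
  have z_yVx : commute z (y^-1 * x) by apply: commuteM => //; exact: commuteV.
  rewrite !commgEl /conjg !(invgM, invgK) -!mulgA mulVKg.
  by rewrite (mulgA y^-1 x (_ * y)) (mulgA z) z_yVx -!mulgA mulVKg.
exact: commutator_subgroup_comm.
Qed.

End Subgroups.

(** * Braid relations modulo the second derived subgroup *)

Section BraidFamily.
Variable G : groupType.
Local Notation G' := (commutator_subgroup [set: G]).
Local Notation G'' := (commutator_subgroup G').

Let nG' : normal_subgroup G'.
Proof. by apply: commutator_subgroup_normal; exact: normal_setT. Qed.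

Let nG'' : normal_subgroup G''.
Proof. exact: commutator_subgroup_normal. Qed.

Variables (m : nat) (x : nat -> G).
Hypothesis x_far : forall i j, i.+1 < j -> j < m -> commute (x i) (x j).
Hypothesis x_braid : forall i, i.+1 < m ->
  x i * x i.+1 * x i = x i.+1 * x i * x i.+1.

Lemma braid_family_cong_derived i j : i < m -> j < m -> cong G' (x i) (x j).
Proof.
suff cong0 k : k < m -> cong G' (x 0) (x k).
  by move=> /cong0/(cong_sym nG')i0 /cong0; exact: (cong_trans nG' i0).
elim: k => [_|k IHk km]; first exact: (cong_refl nG').
apply: (cong_trans nG' (IHk (ltnW km))); apply: (braid_cong nG').
  exact: x_braid.
exact: commutator_subgroup_comm.
Qed.

(** The generator that commutes with both [x i] and [x i.+1] is [x 3] for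
    [i = 0] and [x 0] for [i >= 2]; for [i = 1] the induction hypothesis
    replaces [x 1] by [x 0], which commutes with [x 2]. *)
Lemma braid_family_cong0 i : 3 < m -> i < m -> cong G'' (x 0) (x i).
Proof.
move=> m3; elim: i => [_|i IHi im]; first exact: (cong_refl nG'').
have {}IHi := IHi (ltnW im); have m_gt0 : 0 < m by exact: leq_trans m3.
apply: (cong_trans nG'' IHi); apply: (braid_cong nG''); first exact: x_braid.
case: i im IHi => [|[|i]] im IHi.
- apply: (@comm_common_centralizer _ _ _ _ (x 3)).
  + exact/commute_sym/x_far.
  + exact/commute_sym/x_far.
  + exact: braid_family_cong_derived.
  + exact: braid_family_cong_derived.
- apply: (commute_mod_cong nG'' (cong_sym nG'' IHi)).
  by apply: (commute_mod_commute nG''); exact: x_far.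
- apply: (@comm_common_centralizer _ _ _ _ (x 0)).
  + by apply: x_far => //; exact: ltnW im.
  + exact: x_far.
  + by apply: braid_family_cong_derived => //; exact: ltnW.
  + exact: braid_family_cong_derived.
Qed.

End BraidFamily.

(** * Groups given by a presentation *)

Section Presented.
Variables (X : choiceType) (R : word X -> word X -> Prop).

Definition pres_word (w : word X) : presented R := \pi w.
Definition pres_gen (a : X) : presented R := pres_word [:: (a, false)].

Lemma presented_wordP (g : presented R) : exists w, g = pres_word w.
Proof. by elim/quotW: g => w; exists w. Qed.

Lemma pres_wordM u v : pres_word (u ++ v) = pres_word u * pres_word v.
Proof. by rewrite /pres_word -(pres_mulE R). Qed.

Lemma pres_word_rel u v : R u v -> pres_word u = pres_word v.
Proof. by move=> uv; apply/pres_piP; exact: pres_rel. Qed.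

Lemma presented_gen (K : set (presented R)) :
  group_closed [in K] -> (forall a, K (pres_gen a)) -> forall g, K g.
Proof.
move=> /group_closedE[K1 KF] Kgen g.
have KV h : K h -> K h^-1 by rewrite -div1g; exact: KF.
have [w ->] := presented_wordP g; elim: w => [|[a b] w IHw].
  by rewrite /pres_word -(pres_oneE R).
have -> : pres_word ((a, b) :: w) = pres_word [:: (a, b)] / (pres_word w)^-1.
  by rewrite invgK -pres_wordM.
apply: KF; last exact: KV.
case: b; last exact: Kgen.
have -> : pres_word [:: (a, true)] = (pres_gen a)^-1.
  exact/esym/(pres_invE R).
exact/KV/Kgen.
Qed.

Section Lift.
Variables (H : groupType) (f : X -> H).

Definition eval_letter (l : X * bool) : H := if l.2 then (f l.1)^-1 else f l.1.
Definition eval_word (w : word X) : H := \prod_(l <- w) eval_letter l.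

Hypothesis fR : forall u v, R u v -> eval_word u = eval_word v.

Lemma eval_word_cat u v : eval_word (u ++ v) = eval_word u * eval_word v.
Proof. exact: big_cat. Qed.

Lemma eval_word_pres_eq u v : pres_eq R u v -> eval_word u = eval_word v.
Proof.
elim=> {u v} // [u v w _ -> //|u u' v v' _ uu' _ vv'|[a b]].
  by rewrite !eval_word_cat uu' vv'.
rewrite /eval_word !big_cons big_nil mulg1.
by case: b; rewrite /eval_letter /= ?mulgV ?mulVg.
Qed.

(** The compatibility of [f] with [R] is an argument, so that the morphism
    structure can be inferred from the term [pres_lift fR]. *)
Definition pres_lift of (forall u v, R u v -> eval_word u = eval_word v) :=
  fun g : presented R => eval_word (repr g).
Local Notation lift := (pres_lift fR).

Lemma pres_lift_word w : lift (pres_word w) = eval_word w.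
Proof. exact/eval_word_pres_eq/pres_repr. Qed.

Lemma pres_lift_gen a : lift (pres_gen a) = f a.
Proof. by rewrite pres_lift_word /eval_word big_seq1. Qed.

Lemma pres_lift_morphism : monoid_morphism lift.
Proof.
split=> [|g h]; last first.
  have [u ->] := presented_wordP g; have [v ->] := presented_wordP h.
  by rewrite -pres_wordM !pres_lift_word eval_word_cat.
rewrite -[1]/(pres_one R) pres_oneE -/(pres_word _) pres_lift_word.
exact: big_nil.
Qed.

HB.instance Definition _ :=
  isUMagmaMorphism.Build (presented R) H lift pres_lift_morphism.

End Lift.
End Presented.

(** * Images of derived subgroups *)

Section Image.
Variables (G H : groupType) (phi : UMagmaMorphism.type G H).

Lemma morph_commutator_subgroup (A : set G) (B : set H) :
    group_closed [in B] ->
    (forall x y, A x -> A y -> B [~ phi x, phi y]) ->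
  forall x, commutator_subgroup A x -> B (phi x).
Proof.
move=> /group_closedE[B1 BF] AB x.
suff: commutator_subgroup A `<=` [set x | B (phi x)] by exact.
apply: commutator_subgroup_sub => [|y z Ay Az] /=.
  2: by rewrite gmulfR; exact: AB.
apply/group_closedE; split=> [|y z By Bz] /=; first by rewrite gmulf1.
by rewrite gmulfF; exact: BF.
Qed.

(** The image of [G'] lies in the abelian group [B], so the image of [G''] is
    trivial; if [G'' = G'], the image of [G] is then abelian. *)
Lemma perfect_derived_image (B : set H) :
    perfect (commutator_subgroup [set: G]) ->
    group_closed [in B] -> (forall x y, B [~ x, y]) ->
    (forall x y, B x -> B y -> commute x y) ->
  forall x y, commute (phi x) (phi y).
Proof.
move=> pG cB BR abB x y; apply/commgP/eqP; rewrite -gmulfR.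
have : commutator_subgroup [set: G] [~ x, y].
  exact: commutator_subgroup_comm.
have im z : commutator_subgroup [set: G] z -> B (phi z).
  by apply: (morph_commutator_subgroup cB) => u v _ _; exact: BR.
rewrite -pG; apply: (morph_commutator_subgroup (B := [set 1])) => [|u v Gu Gv].
  by apply/group_closedE; split=> // u v -> ->; rewrite divg1.
by apply/eqP/commgP/abB; exact: im.
Qed.

End Image.

(** * The welded braid group *)

Section WeldedBraid.
Variable m : nat.
Local Notation G := (WB m.+2).
Local Notation G' := (commutator_subgroup [set: G]).
Local Notation G'' := (commutator_subgroup G').

(** Sequences indexed by [nat] rather than by ordinals, so that the results on
    sequences satisfying the braid relations apply to them. *)
Definition WB_sigma (i : nat) : G := pres_gen _ (inl (inord i)).
Definition WB_rho (i : nat) : G := pres_gen _ (inr (inord i)).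

Lemma far_inord i j :
  i.+1 < j -> j < m.+1 -> @far m.+2 (inord i) (inord j).
Proof.
move=> ij jm; rewrite /far !inordK ?ij //.
by apply: ltn_trans jm; exact: ltnW.
Qed.

Lemma adj_inord i : i.+1 < m.+1 ->
  (inord i.+1 : 'I_m.+1) = (inord i : 'I_m.+1).+1 :> nat.
Proof. by move=> im; rewrite !inordK // ltnW. Qed.

Lemma WB_sigma_far i j :
  i.+1 < j -> j < m.+1 -> commute (WB_sigma i) (WB_sigma j).
Proof.
move=> ij jm; rewrite /commute -!pres_wordM; apply: pres_word_rel.
by apply: braid_comm; exact: far_inord.
Qed.

Lemma WB_rho_far i j :
  i.+1 < j -> j < m.+1 -> commute (WB_rho i) (WB_rho j).
Proof.
move=> ij jm; rewrite /commute -!pres_wordM; apply: pres_word_rel.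
by apply: symm_comm; exact: far_inord.
Qed.

Lemma WB_sigma_rho_far i j :
  i.+1 < j -> j < m.+1 -> commute (WB_sigma i) (WB_rho j).
Proof.
move=> ij jm; rewrite /commute -!pres_wordM; apply: pres_word_rel.
by apply: mixed_comm; exact: far_inord.
Qed.

Lemma WB_sigma_braid i : i.+1 < m.+1 ->
  WB_sigma i * WB_sigma i.+1 * WB_sigma i
    = WB_sigma i.+1 * WB_sigma i * WB_sigma i.+1.
Proof.
move=> im; rewrite -!pres_wordM; apply: pres_word_rel.
by apply: braid_adj; exact: adj_inord.
Qed.

Lemma WB_rho_braid i : i.+1 < m.+1 ->
  WB_rho i * WB_rho i.+1 * WB_rho i = WB_rho i.+1 * WB_rho i * WB_rho i.+1.
Proof.
move=> im; rewrite -!pres_wordM; apply: pres_word_rel.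
by apply: symm_adj; exact: adj_inord.
Qed.

Lemma WB_commute_mod_derived2 (g h : G) : 3 < m.+1 -> commute_mod G'' g h.
Proof.
move=> m3; have nG'' : normal_subgroup G''.
  by do 2!apply: commutator_subgroup_normal; exact: normal_setT.
have sigma0 := braid_family_cong0 WB_sigma_far WB_sigma_braid m3.
have rho0 := braid_family_cong0 WB_rho_far WB_rho_braid m3.
(* Modulo G'' the first argument may be moved to index 0 and the second one to
   index 2, and these two indices are far apart. *)
have comm02 x y i j : commute (x 0) (y 2) -> i < m.+1 -> j < m.+1 ->
    (forall k, k < m.+1 -> cong G'' (x 0) (x k)) ->
    (forall k, k < m.+1 -> cong G'' (y 0) (y k)) ->
  commute_mod G'' (x i) (y j).
  move=> xy im jm x0 y0.
  apply: (commute_mod_cong nG'' (cong_sym nG'' (x0 i im))).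
  apply: (commute_mod_sym nG'').
  apply: (commute_mod_cong nG'' (cong_sym nG'' (y0 j jm))).
  apply: (commute_mod_cong nG'' (y0 2 _)); first exact: ltnW.
  by apply: (commute_mod_commute nG''); exact: commute_sym.
have genE a : exists2 i, i < m.+1 &
    pres_gen (@WB_rel m.+2) a = WB_sigma i
    \/ pres_gen (@WB_rel m.+2) a = WB_rho i.
  case: a => i; exists i => //; [left|right].
    by rewrite /WB_sigma inord_val.
  by rewrite /WB_rho inord_val.
have gen_comm a b :
    commute_mod G'' (pres_gen (@WB_rel m.+2) a) (pres_gen (@WB_rel m.+2) b).
  have m2 : 2 < m.+1 by exact: ltnW.
  have [i im ai] := genE a; have [j jm bj] := genE b.
  case: ai bj => -> [] ->.
  - by apply: comm02 => //; exact: WB_sigma_far.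
  - by apply: comm02 => //; exact: WB_sigma_rho_far.
  - apply: (commute_mod_sym nG''); apply: (comm02 WB_sigma WB_rho) => //.
    exact: WB_sigma_rho_far.
  - by apply: comm02 => //; exact: WB_rho_far.
have comm_gen k b : commute_mod G'' k (pres_gen (@WB_rel m.+2) b).
  by apply: (presented_gen (commute_mod_closed nG'' _)) => a; exact: gen_comm.
apply: (presented_gen (commute_mod_closed nG'' h)) => b /=.
by apply: (commute_mod_sym nG''); exact: comm_gen.
Qed.

Lemma WB_derived_perfect : 3 < m.+1 -> perfect G'.
Proof.
move=> m3; have nG' : normal_subgroup G'.
  by apply: commutator_subgroup_normal; exact: normal_setT.
apply/seteqP; split.
  apply: commutator_subgroup_sub => [|x y _ _].
    exact: commutator_subgroup_closed.
  exact: commutator_subgroup_comm.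
apply: commutator_subgroup_sub => [|x y _ _].
  exact: commutator_subgroup_closed.
exact: WB_commute_mod_derived2.
Qed.

End WeldedBraid.

(** * The map onto the symmetric group of degree three *)

Definition S3_transp (b : bool) : 'S_3 :=
  if b then tperm (inord 1) (inord 2) else tperm (inord 0) (inord 1).

Lemma S3_transp_invol b : S3_transp b * S3_transp b = 1.
Proof. by case: b; exact: tperm2. Qed.

Lemma inord3_neq i j : i < 3 -> j < 3 -> i != j -> (inord i : 'I_3) != inord j.
Proof. by move=> i3 j3; rewrite -val_eqE /= !inordK. Qed.

(** Both sides of the braid relation are the third transposition. *)
Lemma S3_transp_conj b :
  S3_transp b * S3_transp (~~ b) * S3_transp b = tperm (inord 0) (inord 2).
Proof.
have SV : S3_transp b = (S3_transp b)^-1 by case: b; rewrite /= tpermV.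
rewrite {1}SV -mulgA -/((S3_transp (~~ b)) ^ _).
by case: b {SV}; rewrite /= tpermJ ?tpermL ?tpermR ?tpermD ?inord3_neq.
Qed.

Lemma S3_transp_braid b :
  S3_transp b * S3_transp (~~ b) * S3_transp b
    = S3_transp (~~ b) * S3_transp b * S3_transp (~~ b).
Proof.
by have := S3_transp_conj (~~ b); rewrite negbK S3_transp_conj => ->.
Qed.

Lemma S3_transp_not_commute : ~ commute (S3_transp false) (S3_transp true).
Proof.
rewrite /commute => /permP/(_ (inord 0)).
rewrite !permM /= [tperm (inord 1) _ (inord 0)]tpermD ?inord3_neq // !tpermL.
by move/eqP; rewrite (negPf (inord3_neq _ _ _)).
Qed.

Lemma even_perm3_commute (s t : 'S_3) : ~~ s -> ~~ t -> commute s t.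
Proof.
rewrite -!Alt_even => s_even t_even.
have /cyclic_abelian/fingroup.centsP : cyclic 'Alt_'I_3.
  apply: prime_cyclic.
  have := @card_Alt 'I_3; rewrite card_ord => /(_ isT)/eqP.
  by rewrite -[3`!]/(2 * 3)%N eqn_pmul2l // => /eqP ->.
by apply.
Qed.

Definition WB_to_S3_gen n (a : WB_gen n) : 'S_3 :=
  match a with inl i | inr i => S3_transp (odd i) end.

(** The bound on [n] makes any two far apart indices equal to 0 and 2, so that
    the generators that must commute have the same image.  The relations
    between adjacent indices all become the braid relation between the two
    transpositions. *)
Lemma WB_to_S3_rel n (u v : word (WB_gen n)) : n <= 4 ->
  WB_rel u v -> eval_word (@WB_to_S3_gen n) u = eval_word (@WB_to_S3_gen n) v.
Proof.
move=> n4.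
have n3 : n.-1 <= 3 by rewrite -subn1 leq_subLR.
have far_odd (i j : 'I_n.-1) : far i j -> odd i = odd j.
  move: (leq_trans (ltn_ord i) n3) (leq_trans (ltn_ord j) n3); rewrite /far.
  by case: (i : nat) (j : nat) => [|[|[|?]]] [|[|[|?]]].
case=> [i j /far_odd ij|i j ij|i|i j /far_odd ij|i j ij|i j /far_odd ij|i j ij
    |i j ij];
  rewrite /eval_word ?big_cons big_nil /eval_letter /= ?ij ?mulg1 ?mulgA //=;
  by rewrite ?S3_transp_invol ?S3_transp_braid.
Qed.

Theorem corollary1p5 (n : nat) (hn : (3 <= n)%N) :
  perfect (commutator_subgroup [set: WB n]%classic) <-> (5 <= n)%N.
Proof.
split; last first.
  by case: n hn => [|[|m]] // _ n5; exact: WB_derived_perfect.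
move=> pG; rewrite ltnNge; apply/negP => n4.
pose fR u v := @WB_to_S3_rel n u v n4.
pose B : set 'S_3 := [set s | ~~ s].
have cB : group_closed [in B].
  apply/group_closedE; split=> [|s t]; rewrite /B /=.
    by rewrite odd_perm1.
  by rewrite odd_permM odd_permV => /negPf -> /negPf ->.
have BR s t : B [~ s, t].
  rewrite /B /= !odd_permM !odd_permV.
  by case: (odd_perm s) (odd_perm t) => -[].
have abB s t : B s -> B t -> commute s t by exact: even_perm3_commute.
have comm := perfect_derived_image (pres_lift fR) pG cB BR abB.
have i0n : 0 < n.-1 by rewrite -subn1 subn_gt0 ltnW.
have i1n : 1 < n.-1 by rewrite -subn1 ltn_subRL.
have := comm (pres_gen _ (inl (Ordinal i0n))) (pres_gen _ (inl (Ordinal i1n))).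
by rewrite /= !pres_lift_gen; exact: S3_transp_not_commute.
Qed.
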